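(* Let $\Gamma$ be a finite connected graph and fix a coherent cotree $\mathcal{T}^*_\Gamma$ of $\Gamma$. Then $$\mathbb{Z}^{F_\bullet(\Gamma)}=\operatorname{Im}d\;\oplus\;\mathbb{Z}^{\mathcal{B}_\bullet(\Gamma)},$$ where $d:\bigoplus_{S\in F_\bullet(\Gamma)}\mathrm{H}_1(\Gamma\setminus S)\to\mathbb{Z}^{F_\bullet(\Gamma)}$.
   Context: A graph $\Gamma$ is a finite connected oriented multigraph, loops allowed: finite sets $V$, $E$ and maps $h,t:E\to V$. A bond is a minimal set of edges whose removal increases the number of connected components. A spanning cotree is the complement in $E$ of (the edge set of) a spanning tree. $F_\bullet(\Gamma)$ is the set of subsets of $E$ containing no bond (equivalently, contained in a spanning cotree). $\Gamma\setminus S$ is deletion of the edges in $S$. $\mathrm{H}_1(\Gamma)=\ker(\mathbb{Z}^E\to\mathbb{Z}^V,\ e\mapsto h(e)-t(e))$, and $\langle\gamma,e\rangle$ is the $e$-coordinate of $\gamma$. The generator of $\mathbb{Z}^{F_\bullet(\Gamma)}$ corresponding to $S$ is $1_S$. The map $d$ sends $\gamma$ in the summand $\mathrm{H}_1(\Gamma\setminus S)$ to $\sum_{e}\langle\gamma,e\rangle 1_{S\cup e}$, the sum over $e\in E\setminus S$ with $S\cup e\in F_\bullet(\Gamma)$. A coherent cotree of $\Gamma$ is a function $\mathcal{T}^*_\Gamma:F_\bullet(\Gamma)\to2^E$ such that $\mathcal{T}^*_\Gamma(S)$ is a spanning cotree of $\Gamma\setminus S$ for every $S$, and $\mathcal{T}^*_\Gamma(S_1)\subseteq\mathcal{T}^*_\Gamma(S_2)$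 whenever $S_2\subseteq S_1$. Given one, for $S\in F_\bullet(\Gamma)$ let $\mathcal{D}_\Gamma(S)=\{e\in S\mid e\in\mathcal{T}^*_\Gamma(S\setminus e)\}$, and $\mathcal{B}_\bullet(\Gamma)=\{S\in F_\bullet(\Gamma)\mid\mathcal{D}_\Gamma(S)=\emptyset\}$; $\mathbb{Z}^{\mathcal{B}_\bullet(\Gamma)}$ is the subgroup of $\mathbb{Z}^{F_\bullet(\Gamma)}$ spanned by $1_S$, $S\in\mathcal{B}_\bullet(\Gamma)$. *)

(* Defs.v *)
From HB Require Import structures.
From mathcomp Require Import all_boot all_order all_algebra.
Set Implicit Arguments.
Unset Strict Implicit.
Unset Printing Implicit Defensive.
Import Order.TTheory GRing.Theory Num.Theory.
Local Open Scope ring_scope.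

Record multigraph := Multigraph {
  vertex : finType;
  edge : finType;
  head : edge -> vertex;
  tail : edge -> vertex }.

(* A spanning subgraph (V, A) of G is represented by its set A of edges;      *)
(* in particular G \ S is represented by ~: S, and G itself by setT.          *)
Section SpanningSubgraphs.
Variable G : multigraph.
Implicit Types A B C S : {set edge G}.

Definition adj A : rel (vertex G) := fun u v =>
  [exists e in A, ((tail e == u) && (head e == v))
               || ((tail e == v) && (head e == u))].

Definition ncomp A : nat := n_comp (adj A) (vertex G).

Definition connected A : Prop := ncomp A = 1%N.

(* (e, true) is e traversed along its orientation, (e, false) against it.     *)
Definition dart : Type := (edge G * bool)%type.
Definition dart_source (d : dart) := if d.2 then tail d.1 else head d.1.
Definition dart_target (d : dart) := if d.2 then head d.1 else tail d.1.

(* Loops are circuits of length 1; pairs of parallel edges give circuits of   *)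
(* length 2, whereas an edge followed by its reverse is excluded by the       *)
(* distinctness of the edges.                                                 *)
Definition is_circuit A (c : seq dart) : bool :=
  [&& c != [::],
      all (fun d => d.1 \in A) c,
      cycle (fun d d' => dart_target d == dart_source d') c,
      uniq [seq d.1 | d <- c] &
      uniq [seq dart_source d | d <- c]].

Definition is_tree A : Prop :=
  connected A /\ forall c : seq dart, ~~ is_circuit A c.

Definition spanning_tree A B : Prop := B \subset A /\ is_tree B.

Definition spanning_cotree A C : Prop :=
  exists2 B, spanning_tree A B & C = A :\: B.

Definition bond B : bool :=
  minset (fun B' => (ncomp setT < ncomp (~: B'))%N) B.

Definition Fset : {set {set edge G}} :=
  [set S : {set edge G} | [forall B : {set edge G}, bond B ==> ~~ (B \subset S)]].

Definition face : Type := {S : {set edge G} | S \in Fset}.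

HB.instance Definition _ := Finite.on face.
HB.instance Definition _ := SubType.on face.

Lemma FsetD1 S e : S \in Fset -> S :\ e \in Fset.
Proof.
rewrite !inE => /forallP FS; apply/forallP => B; apply/implyP => bB.
apply: contra (implyP (FS B) bB) => /subset_trans; apply.
exact: subsetDl.
Qed.

Definition faceD1 (S : face) (e : edge G) : face :=
  exist _ (val S :\ e) (FsetD1 e (valP S)).

End SpanningSubgraphs.

Definition delta (I : finType) (i : I) : {ffun I -> int} :=
  [ffun j => (j == i)%:R].

Section Differential.
Variable G : multigraph.

Definition boundary (g : {ffun edge G -> int}) : {ffun vertex G -> int} :=
  \sum_(e : edge G) (delta (head e) - delta (tail e)) *~ g e.

(* H_1 of the spanning subgraph (V, A), where Z^A is identified with the      *)
(* subgroup of Z^E of the functions that vanish off A.                        *)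
Definition H1 (A : {set edge G}) (g : {ffun edge G -> int}) : Prop :=
  (forall e, e \notin A -> g e = 0) /\ boundary g = 0.

(* The inner sum has the single term U = S :|: e if this set belongs to F,    *)
(* and is empty otherwise.                                                    *)
Definition d (g : face G -> {ffun edge G -> int}) : {ffun face G -> int} :=
  \sum_(S : face G) \sum_(e | e \notin val S)
    \sum_(U : face G | val U == e |: val S) delta U *~ g S e.

Definition im_d (x : {ffun face G -> int}) : Prop :=
  exists2 g : face G -> {ffun edge G -> int},
    forall S, H1 (~: val S) (g S) & x = d g.

End Differential.

Section CoherentCotree.
Variables (G : multigraph) (T : face G -> {set edge G}).

Definition coherent_cotree : Prop :=
  (forall S : face G, spanning_cotree (~: val S) (T S)) /\
  (forall S1 S2 : face G, val S2 \subset val S1 -> T S1 \subset T S2).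

Definition Dset (S : face G) : {set edge G} :=
  [set e in val S | e \in T (faceD1 S e)].

Definition Bset : {set face G} := [set S | Dset S == set0].

Definition spanB (x : {ffun face G -> int}) : Prop :=
  exists c : face G -> int, x = \sum_(S in Bset) delta S *~ c S.

End CoherentCotree.

(* M is the internal direct sum of its subgroups P and Q.                     *)
Definition is_direct_sum (M : zmodType) (P Q : M -> Prop) : Prop :=
  (forall x, exists y z, [/\ P y, Q z & x = y + z]) /\
  (forall x, P x -> Q x -> x = 0).

(* Main.v *)
(* For e in T S let gam S e be the fundamental cycle of e with respect to the *)
(* spanning tree complementary to T S in G \ S.  If e \in T S then coherence *)
(* forces T (S + e) = T S - e, so D(S + e) = D(S) + e, whereas D(S + f) is *)
(* contained in D(S) if f is not in T S.  Hence, for U outside B and a chosen *)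
(* e in D(U), the vector x_U = d (gam (U - e) e) is 1_U plus a combination of *)
(* 1_V with |D(V)| < |D(U)|.  These x_U form a complement of Z^B.  They also *)
(* span Im d: for e, e' in T R, the Koszul relation obtained from *)
(* gam R e /\ gam R e' shows that d (gam (R + e') e) and d (gam (R + e) e') *)
(* differ by the images of cycles of G \ (R + f) with f not in T R, which are *)
(* treated by induction on |D|. *)
Require Import Defs.
From HB Require Import structures.
From mathcomp Require Import all_boot all_order all_algebra.

Set Implicit Arguments.
Unset Strict Implicit.
Unset Printing Implicit Defensive.

Import Order.TTheory GRing.Theory Num.Theory.
Local Open Scope ring_scope.

(** The graph theory rests on two facts: a flow on an acyclic subgraph vanishes ([acyclic_flow]),
    and an edge added to a connected subgraph closes a cycle with coefficient 1 on it
    ([fundamental_cycle]). They show that nested spanning trees are equal, hence T(S + e) = T(S) - e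
    for e in T(S) ([cotreeU1]), and that fundamental cycles span H_1 ([H1_fundcycle]). When faces
    are ranked by |D|, the vectors x_U, called [leading] below, are unitriangular, so
    [unitriangular_direct_sum] makes their span a complement of Z^B. [im_dE] identifies that span
    with Im d; its hard inclusion is [dface_fundcycle_span]. *)

Section Graph.
Variable G : multigraph.
Implicit Types (A B C : {set edge G}) (g : {ffun edge G -> int}).

(** * Connectivity and bond-free edge sets *)

Lemma adj_connect_sym A : connect_sym (adj A).
Proof.
apply: sym_connect_sym => u v; apply: eq_existsb => e.
by rewrite orbC.
Qed.

Lemma connected_connect A : connected A -> forall u v, connect (adj A) u v.
Proof.
move=> cA u v; rewrite -(root_connect (adj_connect_sym A)); apply/eqP.
have /card_le1_eqP : (#|predI (roots (adj A)) (vertex G)| <= 1)%N.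
  by rewrite -[X in (_ <= X)%N]cA.
by apply; rewrite !inE /= roots_root //; apply: adj_connect_sym.
Qed.

Lemma connectedS A B : A \subset B -> connected A -> connected B.
Proof.
move=> sAB cA.
have /card_gt0P[v _] : (0 < #|predI (roots (adj A)) (vertex G)|)%N.
  by rewrite -[X in (_ < X)%N]/(ncomp A) cA.
rewrite /connected /ncomp -(n_comp_connect (adj_connect_sym B) v).
apply: eq_n_comp_r => u; rewrite !inE; symmetry.
apply: connect_sub (connected_connect cA v u) => {cA}x y /existsP[e /andP[eA exy]].
apply: connect1; apply/existsP; exists e.
by rewrite (subsetP sAB).
Qed.

(** Deleting edges of S leaves the connected subgraph A intact, so it cannot raise the number of
    components, whereas deleting a bond does. *)
Lemma Fset_connected A (S : {set edge G}) : A \subset ~: S -> connected A -> S \in Fset G.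
Proof.
move=> sAS cA; rewrite inE; apply/forallP => B; apply/implyP => /minsetp bB.
apply: contraL bB => sBS; rewrite -leqNgt.
rewrite [ncomp (~: B)](connectedS _ cA) ?(subset_trans sAS) ?setCS //.
by rewrite [ncomp setT](connectedS _ cA) ?subsetT.
Qed.

Lemma FsetS A B : A \subset B -> B \in Fset G -> A \in Fset G.
Proof.
move=> sAB; rewrite !inE => /forallP FB; apply/forallP => C; apply/implyP => bB.
by apply: contra (implyP (FB C) bB) => /subset_trans; apply.
Qed.

(** * Flows, circuits and spanning trees *)

Lemma boundaryE g v :
  boundary g v = \sum_e ((Defs.head e == v)%:R - (tail e == v)%:R) * g e.
Proof.
rewrite /boundary sum_ffunE; apply: eq_bigr => e _.
by rewrite ffunMzE !ffunE -mulrzr intz ![v == _]eq_sym.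
Qed.

Lemma boundary_is_zmod : zmod_morphism (@boundary G).
Proof.
move=> g g'; apply/ffunP => v; rewrite !ffunE !boundaryE -sumrB.
by apply: eq_bigr => e _; rewrite !ffunE mulrBr.
Qed.
HB.instance Definition _ := GRing.isZmodMorphism.Build _ _ (@boundary G) boundary_is_zmod.

Lemma boundary_delta (e : edge G) : boundary (delta e) = delta (Defs.head e) - delta (Defs.tail e).
Proof.
rewrite /boundary (bigD1 e) //= ffunE eqxx big1 ?addr0 // => f /negPf fe.
by rewrite ffunE fe.
Qed.

Lemma connect_flow A u v : connect (adj A) u v ->
  exists2 g : {ffun edge G -> int}, forall e, e \notin A -> g e = 0
    & boundary g = delta v - delta u.
Proof.
case/connectP => p; elim: p u => [|w p IHp] u /=.
  by move=> _ ->; exists 0 => [e _|]; rewrite ?ffunE ?subrr ?raddf0.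
case/andP=> /existsP[e /andP[eA euw]] /IHp/[apply]-[g gA dg].
have [h hA dh] : exists2 h : {ffun edge G -> int},
    forall f, f \notin A -> h f = 0 & boundary h = delta w - delta u.
  have dA f : f \notin A -> @delta (edge G) e f = 0.
    by move=> fA; rewrite ffunE; case: eqP fA => // ->; rewrite eA.
  case/orP: euw => /andP[/eqP <- /eqP <-].
    by exists (delta e); [|apply: boundary_delta].
  exists (- delta e) => [f /dA df|]; first by rewrite ffunE df oppr0.
  by rewrite raddfN /= boundary_delta opprB.
exists (g + h) => [f fA|]; first by rewrite ffunE gA ?hA ?addr0.
by rewrite raddfD /= dg dh addrA subrK.
Qed.

(* Following the positive darts of a nonzero flow, oriented by the sign of g, *)
(* one eventually runs through a circuit.                                     *)
Lemma acyclic_flow A g : (forall c, ~~ is_circuit A c) ->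
  H1 A g -> g = 0.
Proof.
move=> acA [gA dg]; apply/ffunP => e0; rewrite ffunE; apply/eqP/negPn/negP => g0.
pose pos (x : dart G) := if x.2 then 0 < g x.1 else g x.1 < 0.
pose x0 : dart G := (e0, 0 < g e0).
have pos0 : pos x0.
  by rewrite /pos /x0 /=; case: ltrgt0P g0 => //= ->; rewrite eqxx.
pose W v := [exists x : dart G, pos x && (dart_source x == v)].
pose out v := odflt x0 [pick x | pos x && (dart_source x == v)].
pose N v := dart_target (out v).
have outP v : W v -> pos (out v) /\ dart_source (out v) = v.
  rewrite /W /out; case: pickP => [x /andP[px /eqP sx] _ // | no /existsP[x]].
  by rewrite no.
(* If no positive dart left [v], all terms of the boundary at [v] would be nonnegative; they sum to
   0, yet the term of [x] is positive. *)
have posW x : pos x -> W (dart_target x).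
  move=> px; set v := dart_target x; apply: contraT => nWv.
  have nW y : ~~ (pos y && (dart_source y == v)).
    by apply: contra nWv => Py; apply/existsP; exists y.
  have t_ge0 e : 0 <= ((Defs.head e == v)%:R - (tail e == v)%:R) * g e.
    move: (nW (e, true)) (nW (e, false)); rewrite /pos /dart_source /=.
    case: (ltrgt0P (g e)) => /= [ge|ge|-> _ _]; last by rewrite mulr0.
      move=> /negPf -> _; rewrite subr0 mulr_ge0 ?ler0n // ltW //.
    move=> _ /negPf ->; rewrite sub0r mulNr -mulrN mulr_ge0 ?ler0n //.
    by rewrite oppr_ge0 ltW.
  have /eqP := boundaryE g v; rewrite dg ffunE eq_sym psumr_eq0 //.
  move/allP/(_ x.1 (mem_index_enum _)).
  have sx: dart_source x != v by move: (nW x); rewrite px.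
  move: px sx; rewrite /v /pos /dart_source /dart_target.
  case: x {nW nWv t_ge0 v} => e [] /= ge /negPf sx.
    by rewrite eqxx sx subr0 mul1r gt_eqF.
  by rewrite eqxx sx sub0r mulN1r oppr_eq0 lt_eqF.
have NW v : W v -> W (N v) by move=> /outP[/posW].
have iterW v k : W v -> W (iter k N v) by move=> Wv; elim: k => //= k; apply: NW.
have [v Wv cyc] : exists2 v, W v & fcycle N (orbit N v).
  pose u := dart_source x0.
  have Wu : W u by apply/existsP; exists x0; rewrite pos0 eqxx.
  (* The iterates of [u] return to the [k]-th one, so the cycle starts there and not necessarily at
     [u]. *)
  have /trajectP[k lt_k eq_k] := looping_order N u.
  exists (iter k N u); first exact: iterW.
  apply/(orbitPcycle 3 0); exists (order N u - k).-1.
  by rewrite prednK ?subn_gt0 // -iterD subnK // ltnW.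
have orbW w : w \in orbit N v -> W w.
  by rewrite -fconnect_orbit => /iter_findex <-; apply: iterW.
have srcK w : w \in orbit N v -> dart_source (out w) = w by move/orbW/outP=> [].
apply/negP: (acA (map out (orbit N v))) => /=; apply/negPn/and5P; split.
- by rewrite /orbit -orderSpred.
- apply/allP => _ /mapP[w /orbW/outP[pw _] ->]; apply/negPn/negP => /gA gw.
  by move: pw; rewrite /pos gw ltxx; case: ifP.
- rewrite cycle_map.
  apply: (sub_in_cycle (P := [in orbit N v]) _ _ cyc); last by apply/allP.
  by move=> w w' wo wo' /= /eqP <-; rewrite srcK // -/(N w) -fconnect_orbit;
    rewrite (connect_trans _ (fconnect1 N w)) // fconnect_orbit.
(* The sign of g on an edge decides which of its two darts is positive, so distinct positive darts
   lie on distinct edges. *)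
- rewrite map_inj_in_uniq; last first.
    move=> _ _ /mapP[w /orbW/outP[pw _] ->] /mapP[w' /orbW/outP[pw' _] ->].
    case: (out w) pw => e b; case: (out w') pw' => e' b' /=; rewrite /pos /=.
    move=> p' p ee; move: p p'; rewrite ee.
    by case: b b' => [] [] // => /lt_trans h /h; rewrite ltxx.
  rewrite map_inj_in_uniq ?orbit_uniq // => w w' wo wo' eq_out.
  by rewrite -[w]srcK // eq_out srcK.
- rewrite -map_comp map_id_in ?orbit_uniq // => w wo; exact: srcK.
Qed.

(** A unit flow inside A from the head of e back to its tail is closed up by e. *)
Lemma fundamental_cycle A e : connected A -> e \notin A ->
  exists g : {ffun edge G -> int}, [/\ H1 (e |: A) g & g e = 1].
Proof.
move=> cA eA.
have [g gA dg] := connect_flow (connected_connect cA (Defs.head e) (tail e)).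
exists (g + delta e); split; last by rewrite !ffunE eqxx gA ?add0r.
split=> [f|]; last by rewrite raddfD /= dg boundary_delta addrA subrK subrr.
by rewrite !inE negb_or => /andP[/negPf fe fA]; rewrite !ffunE fe gA.
Qed.

(** An edge of B outside A would close a nonzero cycle with A, and this cycle would lie in the
    acyclic B. *)
Lemma spanning_tree_eq A B : A \subset B -> is_tree A -> is_tree B -> A = B.
Proof.
move=> sAB [cA _] [_ acB]; apply/eqP; rewrite eqEsubset sAB.
apply/subsetP => e eB; apply/negPn/negP => eA.
have [g [gH ge]] := fundamental_cycle cA eA.
suff g0: g = 0 by move: ge; rewrite g0 ffunE => /esym/eqP; rewrite oner_eq0.
apply: (acyclic_flow acB); case: gH => gA dg; split=> // f fB; apply: gA.
by apply: contra fB; rewrite in_setU1 => /predU1P[->|/(subsetP sAB)].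
Qed.

End Graph.

(** * Integer spans and unitriangular families *)

Section IntegerSpan.
Variables (I : finType) (M : zmodType).
Implicit Types (P : pred I) (x : I -> M) (y z : M).

Definition zspan P x y := exists a : I -> int, y = \sum_(i | P i) x i *~ a i.

Lemma zspan0 P x : zspan P x 0.
Proof. by exists (fun=> 0); rewrite big1. Qed.

Lemma zspanD P x y z : zspan P x y -> zspan P x z -> zspan P x (y + z).
Proof.
move=> [a ->] [b ->]; exists (fun i => a i + b i); rewrite -big_split /=.
by apply: eq_bigr => i _; rewrite mulrzDr.
Qed.

Lemma zspanMz P x y k : zspan P x y -> zspan P x (y *~ k).
Proof.
move=> [a ->]; exists (fun i => a i * k); rewrite mulrz_suml.
by apply: eq_bigr => i _; rewrite mulrzA.
Qed.

Lemma zspanN P x y : zspan P x y -> zspan P x (- y).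
Proof. by rewrite -mulrN1z; apply: zspanMz. Qed.

Lemma zspan_sum (J : Type) (s : seq J) (Q : pred J) (F : J -> M) P x :
  (forall j, Q j -> zspan P x (F j)) -> zspan P x (\sum_(j <- s | Q j) F j).
Proof. exact: (big_ind _ (zspan0 P x) (@zspanD P x)). Qed.

Lemma zspan_gen P x i : P i -> zspan P x (x i).
Proof.
move=> Pi; exists (fun j => (j == i)%:R); rewrite (bigD1 i) //= eqxx big1 ?addr0 //.
by move=> j /andP[_ /negPf ->].
Qed.

End IntegerSpan.

Lemma ffun_delta_sum (I : finType) (y : {ffun I -> int}) :
  y = \sum_i delta i *~ y i.
Proof.
apply/ffunP => j; rewrite sum_ffunE (bigD1 j) //= big1 => [|i ij].
  by rewrite ffunMzE !ffunE eqxx addr0 intz.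
by rewrite ffunMzE !ffunE eq_sym (negPf ij) mul0rz.
Qed.

(** Each [x i] is [delta i] plus terms of smaller rank [r], so induction on [r] expresses every
    [delta i] through the [x] outside B and the [delta] inside B. *)
Lemma unitriangular_direct_sum (I : finType) (r : I -> nat) (B : {set I})
    (x : I -> {ffun I -> int}) :
  (forall i, i \notin B -> x i i = 1) ->
  (forall i j, i \notin B -> j != i -> x i j != 0 -> (r j < r i)%N) ->
  is_direct_sum (zspan (fun i => i \notin B) x) (zspan (fun i => i \in B) (@delta I)).
Proof.
move=> x1 xr; split=> [y | _ [a ->] [c eq_ac]].
  pose z i := if i \in B then delta i else x i.
  have zdelta n i : (r i < n)%N -> zspan predT z (delta i).
    elim: n i => // n IHn i rin; have [Pi|Pi] := boolP (i \in B).
      by have := @zspan_gen _ _ predT z i isT; rewrite /z Pi.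
    have -> : delta i = x i - \sum_(j | j != i) delta j *~ x i j.
      apply/eqP; rewrite eq_sym subr_eq eq_sym.
      by rewrite [X in _ == X]ffun_delta_sum [X in _ == X](bigD1 i) //= x1.
    apply: zspanD; first by have := @zspan_gen _ _ predT z i isT; rewrite /z (negPf Pi).
    apply/zspanN/zspan_sum => j ji; have [->|xij] := eqVneq (x i j) 0.
      exact: zspan0.
    apply/zspanMz/IHn; exact: leq_trans (xr _ _ Pi ji xij) _.
  have [a ->] : zspan predT z y.
    rewrite [y]ffun_delta_sum; apply: zspan_sum => i _.
    exact/zspanMz/(zdelta (r i).+1).
  exists (\sum_(i | i \notin B) x i *~ a i), (\sum_(i in B) delta i *~ a i).
  split; [by exists a | by exists a | rewrite (bigID (mem B)) /= addrC; congr (_ + _)].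
    by apply: eq_bigr => i /negPf Pi; rewrite /z Pi.
  by apply: eq_bigr => i Pi; rewrite /z Pi.
suff a0 i : i \notin B -> a i = 0 by rewrite big1 // => i /a0 ->; rewrite mulr0z.
move=> Pi; apply/eqP/negPn/negP => ai.
(* Among the indices with nonzero coefficient take [j] of maximal rank: no other such [x k] meets
   coordinate [j], so this coordinate is [a j] on the left, but 0 on the right. *)
have [j /andP[Pj aj] maxj] := @arg_maxnP _ i [pred i | (i \notin B) && (a i != 0)] r
  (introT andP (conj Pi ai)).
have /ffunP/(_ j) := eq_ac; rewrite !sum_ffunE [RHS]big1 => [|k Pk]; last first.
  rewrite ffunMzE ffunE; case: eqP => [jk|_]; last exact: mul0rz.
  by rewrite jk Pk in Pj.
rewrite (bigD1 j) //= ffunMzE x1 // intz big1 => [|k /andP[Pk kj]].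
  by rewrite addr0 => /eqP; apply/negP.
rewrite ffunMzE; have [->|ak] := eqVneq (a k) 0; first by rewrite mulr0z.
have [->|xkj] := eqVneq (x k j) 0; first by rewrite mul0rz.
have := maxj k; rewrite /= Pk ak => /(_ isT).
by rewrite leqNgt xr // eq_sym.
Qed.

Definition face_of (G : multigraph) (A : {set edge G}) (FA : A \in Fset G) : face G :=
  exist _ A FA.

(** * The differential on one summand and the Koszul relation *)

Section Cycles.
Variable G : multigraph.
Implicit Types (A : {set edge G}) (g : {ffun edge G -> int}) (S : face G).

Lemma H1B A g g' : H1 A g -> H1 A g' -> H1 A (g - g').
Proof.
move=> [gA dg] [gA' dg']; split=> [e eA|]; last by rewrite raddfB /= dg dg' subrr.
by rewrite !ffunE gA ?gA' ?subrr.
Qed.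

Lemma H1Mz A g k : H1 A g -> H1 A (g *~ k).
Proof.
move=> [gA dg]; split=> [e eA|]; last by rewrite raddfMz /= dg mul0rz.
by rewrite ffunMzE gA ?mul0rz.
Qed.

Lemma H1_sum (J : finType) (P : pred J) (F : J -> {ffun edge G -> int}) A :
  (forall j, P j -> H1 A (F j)) -> H1 A (\sum_(j | P j) F j).
Proof.
move=> H1F; apply: big_ind => // [|g g' H1g H1g'].
  by split=> [e _|]; rewrite ?ffunE ?raddf0.
by rewrite -[g']opprK; apply: H1B => //; rewrite -mulrN1z; apply: H1Mz.
Qed.

Lemma faceD1K S (U : face G) e :
  e \notin val S -> val U = e |: val S -> faceD1 U e = S.
Proof. by move=> eS UE; apply: val_inj; rewrite /= UE setU1K. Qed.

(** The component of [d] at S, on all integer functions and not only on cycles; [d g] is by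
    conversion the sum of the [dface S (g S)]. *)
Definition dface S g : {ffun face G -> int} :=
  \sum_(e | e \notin val S) \sum_(U : face G | val U == e |: val S) delta U *~ g e.

Lemma dface_is_zmod S : zmod_morphism (dface S).
Proof.
move=> g g'; rewrite /dface -sumrB; apply: eq_bigr => e _; rewrite -sumrB.
by apply: eq_bigr => U _; rewrite !ffunE mulrzBr.
Qed.
HB.instance Definition _ S :=
  GRing.isZmodMorphism.Build _ _ (dface S) (dface_is_zmod S).

Lemma im_d_dface S g : H1 (~: val S) g -> im_d (dface S g).
Proof.
move=> gH; exists (fun S' => if S' == S then g else 0) => [S'|].
  by case: eqP => [->|_] //; split=> [e _|]; rewrite ?ffunE ?raddf0.
rewrite -[RHS]/(\sum_S' dface S' _) (bigD1 S) //= eqxx big1 ?addr0 //.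
by move=> S' /negPf ->; apply: raddf0.
Qed.

Lemma im_d0 : im_d (0 : {ffun face G -> int}).
Proof.
exists (fun=> 0) => [S|]; first by split=> [e _|]; rewrite ?ffunE ?raddf0.
by rewrite -[RHS]/(\sum_S dface S 0) big1 // => S _; apply: raddf0.
Qed.

Lemma im_dD (x y : {ffun face G -> int}) : im_d x -> im_d y -> im_d (x + y).
Proof.
move=> [g gH ->] [g' gH' ->]; exists (fun S => g S - (- g' S)) => [S|].
  by apply: H1B => //; rewrite -mulrN1z; apply: H1Mz.
rewrite -[RHS]/(\sum_S dface S _) -[d g]/(\sum_S dface S _).
rewrite -[d g']/(\sum_S dface S _) -big_split; apply: eq_bigr => S _.
by rewrite opprK raddfD.
Qed.

Lemma sum_face_val (M : zmodType) (F : face G -> M) S A :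
  val S = A -> \sum_(U : face G | val U == A) F U = F S.
Proof. by move=> <-; apply: big_pred1 => U; rewrite (inj_eq val_inj). Qed.

Lemma dface_coef S g e U :
  e \notin val S -> val U = e |: val S -> dface S g U = g e.
Proof.
move=> eS UE; rewrite sum_ffunE (bigD1 e) //= (sum_face_val _ UE).
rewrite ffunMzE ffunE eqxx intz big1 ?addr0 // => f /andP[fS fe].
rewrite sum_ffunE big1 // => V /eqP VE; rewrite ffunMzE ffunE.
case: eqP => [UV|]; rewrite ?mul0rz //.
have : f \in val V by rewrite (VE : val V = _) setU11.
by rewrite -UV UE !inE (negPf fe) (negPf fS).
Qed.

Lemma dface_supp S g U : dface S g U != 0 ->
  exists f, [/\ f \notin val S, val U = f |: val S & g f != 0].
Proof.
case: (pickP [pred f | [&& f \notin val S, val U == f |: val S & g f != 0]]).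
  by move=> f /and3P[fS /eqP UE gf]; exists f.
move=> no; rewrite sum_ffunE big1 ?eqxx // => f fS.
rewrite sum_ffunE big1 // => V VE; rewrite ffunMzE ffunE.
case: eqP => [UV|]; rewrite ?mul0rz //.
by have := no f; rewrite /= fS UV VE /= => /negbFE/eqP ->; rewrite mulr0z.
Qed.

(* The square of the Koszul differential vanishes on [a /\ b].                *)
Lemma koszul_relation S (a b : {ffun edge G -> int}) :
  \sum_(f | f \notin val S) \sum_(W : face G | val W == f |: val S)
    dface W (b *~ a f - a *~ b f) = 0.
Proof.
(* The generator of S + e + f, or 0 when this set contains a bond; it is symmetric in the two
   edges. *)
pose c e f := \sum_(V : face G | val V == f |: (e |: val S)) delta V.
have innerE f : f \notin val S ->
    \sum_(W : face G | val W == f |: val S) dface W (b *~ a f - a *~ b f) =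
    \sum_(h | h \notin f |: val S) c f h *~ (a f * b h)
      - \sum_(h | h \notin f |: val S) c f h *~ (b f * a h).
  move=> fS; rewrite -sumrB.
  have [FW|nF] := boolP (f |: val S \in Fset G).
    rewrite (@sum_face_val _ _ (face_of FW)) //.
    apply: eq_bigr => h _; rewrite /c !mulrz_suml -sumrB; apply: eq_bigr => V _.
    by rewrite -mulrzBr !ffunE !ffunMzE !mulrzz [b h * _]mulrC [a h * _]mulrC.
  (* If S + f contains a bond, so does S + f + h, and both sides vanish. *)
  rewrite big1 => [|W /eqP WE]; last by rewrite -WE (valP W) in nF.
  rewrite big1 // => h _; rewrite /c big_pred0 ?mul0rz ?subrr // => V.
  apply/negP => /eqP VE; case/negP: nF; apply: FsetS (valP V).
  by rewrite VE subsetUr.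
(* Exchanging the roles of [f] and [h] turns one double sum into the other, by the symmetry of
   [c]. *)
rewrite (eq_bigr _ innerE) sumrB; apply/eqP; rewrite subr_eq0; apply/eqP.
rewrite (exchange_big_dep (fun h => h \notin val S)) /=; last first.
  by move=> f h _; rewrite !inE negb_or => /andP[].
apply: eq_bigr => h hS; apply: eq_big => f; last first.
  by move=> _; rewrite mulrC /c setUCA.
by rewrite !inE !negb_or hS andbT eq_sym andbC.
Qed.

End Cycles.

(** * Coherent cotrees, fundamental cycles and the image of d *)

Section CoherentCotree.
Variables (G : multigraph) (T : face G -> {set edge G}).
Hypothesis hT : coherent_cotree T.
Implicit Types (S U W : face G) (e f : edge G).

Lemma cotree_notin S e : e \in T S -> e \notin val S.
Proof.
by have [[B _ ->] _] := (hT.1 S, tt); rewrite !inE => /andP[].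
Qed.

Lemma cotree_tree S : is_tree (~: val S :\: T S).
Proof.
have [[B [sB tB] ->] _] := (hT.1 S, tt).
by rewrite setDDr setDv set0U (setIidPr sB).
Qed.

(** The spanning tree complementary to T(S) survives the deletion of e. *)
Lemma cotree_FsetU S e : e \in T S -> e |: val S \in Fset G.
Proof.
move=> eT; apply: Fset_connected (cotree_tree S).1.
apply/subsetP => f; rewrite !inE => /andP[fT fS].
by rewrite negb_or fS andbT; apply: contraNneq fT => ->.
Qed.

(** By coherence T(U) lies in T(S), so the tree left by T(S) lies in the one left by T(U); nested
    spanning trees coincide. *)
Lemma cotreeU1 S U e : e \in T S -> val U = e |: val S -> T U = T S :\ e.
Proof.
move=> eT UE; have sTU : T U \subset T S by apply: hT.2; rewrite UE subsetUr.
have tree_eq : ~: val S :\: T S = ~: val U :\: T U.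
  apply: spanning_tree_eq; [|exact: cotree_tree|exact: cotree_tree].
  apply/subsetP => f; rewrite !inE UE !inE negb_or => /andP[fT ->].
  rewrite andbT (contra (subsetP sTU f) fT).
  by apply: contraNneq fT => ->.
apply/setP => f; rewrite !inE; apply/idP/andP => [fU|[fe fS]].
  rewrite (subsetP sTU) //; split=> //; apply: contraTneq fU => ->.
  by apply/negP => /cotree_notin; rewrite UE setU11.
have /setP/(_ f) := tree_eq; rewrite !inE fS /= UE !inE (negPf fe) /=.
by rewrite (cotree_notin fS) andbT => /esym/negbFE.
Qed.

(** For f in S, coherence puts e in T(S - f), so [cotreeU1] gives T(U - f) = T(S - f) - e and
    membership of f is unchanged; e itself is new. *)
Lemma Dset_cotreeU1 S U e : e \in T S -> val U = e |: val S ->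
  Dset T U = e |: Dset T S.
Proof.
move=> eT UE; have eS := cotree_notin eT.
apply/setP => f; rewrite !inE UE !inE; have [->|fe] := eqVneq f e.
  by rewrite (faceD1K eS UE) eT.
case fS: (f \in val S) => //=.
rewrite (@cotreeU1 (faceD1 S f) _ e) ?inE ?fe //=.
  by apply: subsetP eT; apply: hT.2; apply: subsetDl.
by rewrite UE; apply/setP => h; rewrite !inE; case: eqP => // ->; rewrite (negPf fe).
Qed.

Lemma card_Dset_cotreeU1 S U e : e \in T S -> val U = e |: val S ->
  #|Dset T U| = #|Dset T S|.+1.
Proof.
move=> eT /(Dset_cotreeU1 eT) ->; rewrite cardsU1.
by rewrite inE (negPf (cotree_notin eT)).
Qed.

(** The edge f fails the test for D(U), and for h in S coherence gives that T(U - h) lies in T(S -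
    h). *)
Lemma card_Dset_noncotreeU1 S U f : f \notin val S -> f \notin T S ->
  val U = f |: val S -> (#|Dset T U| <= #|Dset T S|)%N.
Proof.
move=> fS fT UE; apply/subset_leq_card/subsetP => h; rewrite !inE UE !inE.
have [-> /= | hf /= /andP[hS hT']] := eqVneq h f.
  by rewrite (faceD1K fS UE) (negPf fT).
rewrite hS /=; apply: subsetP hT'; apply: hT.2.
by rewrite /= UE setSD // subsetUr.
Qed.

(** The fundamental cycle of e is described by its coordinates on the cotree, which determine a
    cycle, rather than by a path in the tree. *)
Definition fundcycle S e (g : {ffun edge G -> int}) :=
  H1 (~: val S) g /\ {in T S, forall f, g f = (f == e)%:R}.

Lemma fundcycle_exists S e : e \in T S -> exists g, fundcycle S e g.
Proof.
move=> eT; have [|g [[gA dg] ge]] := @fundamental_cycle _ _ e (cotree_tree S).1.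
  by rewrite !inE eT.
exists g; split=> [|f fT].
  split=> // f; rewrite inE negbK => fS; apply: gA; rewrite !inE fS andbF orbF.
  by apply: contraTneq fS => ->; apply: cotree_notin.
have [->|fe] := eqVneq f e; first by [].
by apply: gA; rewrite !inE (negPf fe) fT.
Qed.

Variable gam : face G -> edge G -> {ffun edge G -> int}.
Hypothesis gamP : forall S e, e \in T S -> fundcycle S e (gam S e).

(** The difference of the two sides vanishes on the cotree, so it is a flow on a tree. *)
Lemma H1_fundcycle S g : H1 (~: val S) g ->
  g = \sum_(e in T S) gam S e *~ g e.
Proof.
move=> gS; apply/eqP; rewrite -subr_eq0; apply/eqP.
apply: (acyclic_flow (cotree_tree S).2).
have [hS dh] : H1 (~: val S) (g - \sum_(e in T S) gam S e *~ g e).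
  by apply/H1B/H1_sum => // e /gamP[gH _]; apply: H1Mz.
split=> // f; rewrite !inE negb_and !negbK => /orP[fT|fS]; last first.
  by apply: hS; rewrite inE negbK.
rewrite !ffunE sum_ffunE (bigD1 f) //= big1 => [|e /andP[eT ef]].
  by rewrite addr0 ffunMzE (gamP fT).2 // eqxx intz subrr.
by rewrite ffunMzE (gamP eT).2 // eq_sym (negPf ef) mul0rz.
Qed.

(** The cycle [gam S e] avoids f, so it lives in the complement of W and has the right coordinates
    on the smaller cotree T(S) - f. *)
Lemma fundcycle_cotreeU1 S W e f : f \in T S -> e \in T S -> e != f ->
  val W = f |: val S -> gam W e = gam S e.
Proof.
move=> fT eT ef WE; have [H1g gT] := gamP eT.
have H1W : H1 (~: val W) (gam S e).
  split=> [h|]; last exact: H1g.2.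
  rewrite inE negbK WE => /setU1P[->|hS]; first by rewrite gT // eq_sym (negPf ef).
  by apply: H1g.1; rewrite inE hS.
rewrite [RHS](H1_fundcycle H1W) (cotreeU1 fT WE) (bigD1 e) ?inE ?ef //= big1 => [|h].
  by rewrite gT // eqxx addr0.
by rewrite !inE => /andP[/andP[_ hT'] /negPf he]; rewrite gT // he.
Qed.

Definition leading U : {ffun face G -> int} :=
  if [pick e in Dset T U] is Some e then dface (faceD1 U e) (gam (faceD1 U e) e)
  else 0.

Lemma leadingP U : U \notin Bset T -> exists S e,
  [/\ e \in T S, val U = e |: val S, S = faceD1 U e & leading U = dface S (gam S e)].
Proof.
rewrite inE /leading => nB; case: pickP => [e|no]; last first.
  by case/negP: nB; apply/eqP/setP => e; rewrite no inE.
rewrite inE => /andP[eU eT]; exists (faceD1 U e), e; split=> //=.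
by rewrite setD1K.
Qed.

Lemma notinB S U e : e \in T S -> val U = e |: val S -> U \notin Bset T.
Proof.
move=> eT UE; rewrite !inE (Dset_cotreeU1 eT UE); apply/set0Pn; exists e.
exact: setU11.
Qed.

(** The edge e' picked for [leading U] need not be e. The Koszul relation at R = S - e' trades one
    for the other, with corrections handled by induction on |D(S)|. *)
Lemma dface_fundcycle_span S e : e \in T S ->
  zspan (fun U => U \notin Bset T) leading (dface S (gam S e)).
Proof.
have [n] := ubnP #|Dset T S|; elim: n S e => // n IHn S e lt_n eT.
have eS := cotree_notin eT.
have [U UE] : exists U : face G, val U = e |: val S.
  by exists (face_of (cotree_FsetU eT)).
have UB := notinB eT UE.
have [S' [e' [eT' UE' S'E lead]]] := leadingP UB.
have [ee|ee] := eqVneq e' e.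
  have SS : S' = S by rewrite S'E ee (faceD1K eS UE).
  by rewrite -SS -ee -lead; apply: zspan_gen.
(* As D(U) = D(S) + e and e' differs from e, the edge e' lies in D(S); this gives R and places both
   e and e' in T(R). *)
have eD' : e' \in Dset T U.
  by rewrite (Dset_cotreeU1 eT' UE') setU11.
move: eD'; rewrite (Dset_cotreeU1 eT UE) in_setU1 (negPf ee) inE /=.
case/andP=> e'S e'R; have SE : val S = e' |: val (faceD1 S e') by rewrite /= setD1K.
have eR : e \in T (faceD1 S e').
  by apply: subsetP eT; apply: hT.2; apply: subsetDl.
have S'R : val S' = e |: val (faceD1 S e').
  rewrite S'E /= UE; apply/setP => h; rewrite !inE.
  by case: (eqVneq h e) => // ->; rewrite eq_sym ee.
move: (faceD1 S e') => R in e'R SE eR S'R *.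
have [H1a aT] := gamP eR; have [H1b bT] := gamP e'R.
pose a := gam R e; pose b := gam R e'.
(* The contraction of a /\ b by [f] vanishes at [f], so it is a cycle of the complement of R + f. *)
have H1ab W f : val W = f |: val R -> H1 (~: val W) (b *~ a f - a *~ b f).
  have [_ dab] := H1B (H1Mz (a f) H1b) (H1Mz (b f) H1a).
  move=> WE; split=> // h; rewrite inE negbK WE !ffunE !ffunMzE.
  case/setU1P=> [->|hR]; first by rewrite !mulrzz mulrC subrr.
  have hR' : h \notin ~: val R by rewrite inE negbK.
  by rewrite /a /b (H1a.1 _ hR') (H1b.1 _ hR') !mul0rz subrr.
have rel := koszul_relation R a b.
have e'nR := cotree_notin e'R; have enR := cotree_notin eR.
rewrite (bigD1 e) //= (sum_face_val _ S'R) (bigD1 e') ?e'nR //= in rel.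
rewrite (sum_face_val _ SE) in rel.
(* Since [a] and [b] are Kronecker deltas on T(R), contracting by e and by e' leaves b and -a, still
   fundamental cycles after deleting e and e' respectively. *)
have gS' : b *~ a e - a *~ b e = gam S' e'.
  rewrite /a /b aT // bT // eqxx eq_sym (negPf ee) subr0 mulr1z.
  by rewrite (fundcycle_cotreeU1 eR e'R _ S'R).
have gS : b *~ a e' - a *~ b e' = - gam S e.
  rewrite /a /b aT // bT // eqxx (negPf ee) sub0r mulr1z.
  by rewrite (fundcycle_cotreeU1 e'R eR _ SE) // eq_sym.
move: rel; rewrite gS' gS -lead raddfN /= addrCA => /eqP.
rewrite addrC subr_eq0 => /eqP <-.
apply: zspanD; first exact: zspan_gen.
apply: zspan_sum => f /andP[/andP[fR fe] fe'].
apply: zspan_sum => W /eqP WE.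
(* On the other cotree edges both cycles vanish; for f outside T(R), |D(R + f)| is at most |D(R)| <
   |D(S)|, so induction applies. *)
have [fT|fT] := boolP (f \in T R).
  rewrite {1}/a {1}/b aT ?bT // (negPf fe) (negPf fe') !mulr0z subrr raddf0.
  exact: zspan0.
rewrite [X in dface W X](H1_fundcycle (H1ab _ _ WE)) raddf_sum.
apply: zspan_sum => h hW; rewrite raddfMz; apply/zspanMz/IHn => //.
have leW : (#|Dset T W| <= #|Dset T R|)%N := card_Dset_noncotreeU1 fR fT WE.
by apply: leq_ltn_trans leW _; move: lt_n; rewrite (card_Dset_cotreeU1 e'R SE).
Qed.

Lemma im_dE x : im_d x <-> zspan (fun U => U \notin Bset T) leading x.
Proof.
split=> [[g H1g ->] | [c ->]].
  apply: zspan_sum => S _; rewrite -/(dface S (g S)).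
  rewrite (H1_fundcycle (H1g S)) raddf_sum; apply: zspan_sum => e eT.
  by rewrite raddfMz; apply/zspanMz/dface_fundcycle_span.
apply: big_ind => [|y z|U UB]; [exact: im_d0|exact: im_dD|].
have [S [e [eT _ _ ->]]] := leadingP UB.
rewrite -raddfMz /=; exact/im_d_dface/H1Mz/(gamP eT).1.
Qed.

(** Rank faces by |D|. If V = S + f differs from U = S + e and lies in the support of x_U, then f is
    not in T(S), since the fundamental cycle of e meets T(S) only in e; hence |D(V)| is at most
    |D(S)| < |D(U)|. *)
Lemma leading_direct_sum : is_direct_sum
  (zspan (fun U => U \notin Bset T) leading) (zspan (fun U => U \in Bset T) (@delta (face G))).
Proof.
apply: (@unitriangular_direct_sum _ (fun U => #|Dset T U|)) => [U|U V] /leadingP.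
  move=> [S [e [eT UE _ ->]]]; rewrite (dface_coef _ (cotree_notin eT) UE).
  by rewrite (gamP eT).2 ?eqxx.
move=> [S [e [eT UE _ ->]]] VU /dface_supp[f [fS VE gf]].
rewrite (card_Dset_cotreeU1 eT UE) ltnS; apply: (card_Dset_noncotreeU1 fS _ VE).
apply: contra VU => fT; apply/eqP/val_inj; rewrite VE UE.
by move: gf; rewrite (gamP eT).2 //; have [->|] := eqVneq f e.
Qed.

End CoherentCotree.

Theorem mainTheorem5 (G : multigraph) (hG : connected [set: edge G])
    (T : face G -> {set edge G}) (hT : coherent_cotree T) :
  is_direct_sum (@im_d G) (spanB T).
Proof.
have gamE S : exists gam : edge G -> {ffun edge G -> int},
    forall e, e \in T S -> fundcycle T S e (gam e).
  apply: (fin_all_exists (P := fun e g => e \in T S -> fundcycle T S e g)) => e.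
  have [eT|] := boolP (e \in T S); last by exists 0.
  by have [g] := fundcycle_exists hT eT; exists g.
have [gam gamP] := fin_all_exists gamE.
(* [spanB T] unfolds to the integer span of the [delta U] with U in B, so only Im d remains to be
   identified, by [im_dE]. *)
have [dec indep] := leading_direct_sum hT gamP.
split=> [x | x /(im_dE hT gamP)]; last exact: indep.
have [y [z [Py Qz ->]]] := dec x.
by exists y, z; split=> //; apply/(im_dE hT gamP).
Qed.
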